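(* Let $d\ge 1$ and let $X,X_1,X_2,\ldots$ be independent, identically distributed random vectors in $\mathbb{R}^d$ whose common distribution $\mu$ has a density $f$ with respect to Lebesgue measure (no further restriction on $f$ is imposed). Let $n\ge 2$, let $R_{i,n}:=\min_{j\ne i,\ 1\le j\le n}\|X_i-X_j\|$ for $1\le i\le n$, and let $$P_n:=\max_{1\le i\le n}\mu\big(S(X_i,R_{i,n})\big).$$ Then for every $y\in\mathbb{R}$, $$\mathbb{P}\left(nP_n-\ln n\ge y\right)\le \exp\left(-\frac{n-1}{n}\,y+\frac{\ln n}{n}\right)\mathbb{I}\{y\le n-\ln n\}.$$
   Context: $\|\cdot\|$ is the Euclidean norm on $\mathbb{R}^d$; $S(x,r):=\{y\in\mathbb{R}^d:\|y-x\|\le r\}$ is the closed ball with center $x$ and radius $r$; $\mathbb{I}\{\cdot\}$ is the indicator function. Note that $\mu(S(X_i,R_{i,n}))$ is the random variable obtained by evaluating the function $(x,r)\mapsto\mu(S(x,r))$ at $(X_i,R_{i,n})$. *)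

(* Defs.v *)
From HB Require Import structures.
From mathcomp Require Export all_boot all_order all_algebra.
From mathcomp Require Export all_classical all_reals all_analysis.

Set Implicit Arguments.
Unset Strict Implicit.
Unset Printing Implicit Defensive.

Import Order.TTheory GRing.Theory Num.Theory.
Import numFieldNormedType.Exports.

Local Open Scope classical_set_scope.
Local Open Scope ring_scope.

(* Points of R^d are d-tuples of reals, measurable for the product (= Borel)
   sigma-algebra that the library puts on tuples. *)
Section euclidean_space.
Context {R : realType} {d : nat}.
Implicit Types x y : d.-tuple R.

Definition vsub x y : d.-tuple R := [tuple tnth x i - tnth y i | i < d].

Definition enorm x : R := Num.sqrt (\sum_(i < d) tnth x i ^+ 2).

Definition eball x (r : R) : set (d.-tuple R) :=
  [set y | enorm (vsub y x) <= r].

End euclidean_space.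

Section lebesgue_measure_tuple.
Context {R : realType}.

Definition tcons d (p : measurableTypeR R * d.-tuple R) : d.+1.-tuple R :=
  [tuple of p.1 :: p.2].

(* Lebesgue measure on (the Borel sets of) R^d: the d-fold product of the
   one-dimensional Lebesgue measure, see lebesgue_tuple_box below. *)
Fixpoint lebesgue_tuple d : set (d.-tuple R) -> \bar R :=
  match d with
  | 0 => dirac [tuple]
  | d'.+1 => pushforward (lebesgue_measure \x @lebesgue_tuple d')%E (@tcons d')
  end.
Arguments lebesgue_tuple d : clear implicits.

Lemma measurable_tcons d : measurable_fun [set: _] (@tcons d).
Proof.
by apply: (@measurable_cons _ _ _ R fst d snd); [exact: measurable_fst|
  exact: measurable_snd].
Qed.

Let tuncons d (t : d.+1.-tuple R) : measurableTypeR R * d.-tuple R :=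
  (thead t, [tuple of behead t]).

Let tconsK d : cancel (@tcons d) (@tuncons d).
Proof. by move=> [x t]; congr pair; apply/val_inj. Qed.

Let measurable_tuncons d : measurable_fun [set: _] (@tuncons d).
Proof.
apply/measurable_fun_pair => /=; first exact: measurable_tnth.
exact: measurable_behead.
Qed.

Let pushforward_sigma_finite d1 d2 (T1 : measurableType d1)
    (T2 : measurableType d2) (m : {measure set T1 -> \bar R})
    (u : T1 -> T2) (v : T2 -> T1) :
  sigma_finite setT m ->
  measurable_fun [set: T1] u -> measurable_fun [set: T2] v -> cancel u v ->
  exists q : {sigma_finite_measure set T2 -> \bar R}, pushforward m u = q.
Proof.
move=> [F FT mF] mu mv uK; pose q := pushforward m u.
have q0 : q set0 = 0%E by rewrite /q /pushforward preimage_set0 measure0.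
have q_ge0 A : (0 <= q A)%E by exact: measure_ge0.
have q_sigma : semi_sigma_additive q.
  exact: (@measure_semi_sigma_additive _ _ _ (pushforward m u)).
have q_finite : sigma_finite setT q.
  exists (fun n => v @^-1` F n).
    by rewrite -preimage_bigcup -FT preimage_setT.
  move=> n; have [mFn Fn] := mF n; split.
    by rewrite -[X in measurable X]setTI; exact: mv.
  rewrite /q /pushforward -comp_preimage (_ : _ \o _ = id) ?preimage_id//.
  by apply/funext => x /=; rewrite uK.
rewrite -/q; clearbody q.
pose M := isMeasure.Build _ _ _ q q0 q_ge0 q_sigma.
pose qm : {measure set _ -> \bar R} := HB.pack q M.
pose S := Measure_isSigmaFinite.Build _ _ _ qm q_finite.
pose qs : {sigma_finite_measure set _ -> \bar R} := HB.pack q M S.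
by exists qs.
Qed.

(* For general m1, m2 the sigma-finite structure of m1 \x m2 cannot be inferred:
   the library's instance for products of subprobabilities shadows it. *)
Let pushforward_product_sigma_finite d1 d2 d3 (T1 : measurableType d1)
    (T2 : measurableType d2) (T3 : measurableType d3)
    (m1 : {sigma_finite_measure set T1 -> \bar R})
    (m2 : {sigma_finite_measure set T2 -> \bar R})
    (u : T1 * T2 -> T3) (v : T3 -> T1 * T2) :
  measurable_fun [set: T1 * T2] u -> measurable_fun [set: T3] v -> cancel u v ->
  exists q : {sigma_finite_measure set T3 -> \bar R},
    pushforward (m1 \x m2)%E u = q.
Proof.
suff sf : sigma_finite setT (m1 \x m2)%E.
  move=> mu mv uK.
  exact: (pushforward_sigma_finite (m := (m1 \x m2)%E) sf mu mv uK).
have /sigma_finiteP[F [TF ndF Foo]] := sigma_finiteT m1.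
have /sigma_finiteP[G [TG ndG Goo]] := sigma_finiteT m2.
exists (fun n => F n `*` G n).
  rewrite -setXTT TF TG predeqE => -[x y]; split.
    move=> [/= [n _ Fnx] [k _ Gky]]; exists (maxn n k) => //; split.
    - by move: x Fnx; exact/subsetPset/ndF/leq_maxl.
    - by move: y Gky; exact/subsetPset/ndG/leq_maxr.
  by move=> [n _ []/= ? ?]; split; exists n.
move=> k; have [? ?] := Foo k; have [? ?] := Goo k.
split; first exact: measurableX.
have -> : (m1 \x m2)%E (F k `*` G k) = (m1 (F k) * m2 (G k))%E.
  exact: product_measure1E.
by rewrite lte_mul_pinfty// ge0_fin_numE.
Qed.

Let RT d : measurableType _ := d.-tuple R.

Let lebesgue_tuple_sigma_finite d :
  exists m : {sigma_finite_measure set (RT d) -> \bar R}, lebesgue_tuple d = m.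
Proof.
elim: d => [|d [m mE]] /=; first by eexists (dirac _).
rewrite mE.
have [q qE] := pushforward_product_sigma_finite
  (T2 := RT d) (T3 := RT d.+1) lebesgue_measure m
  (@measurable_tcons d) (@measurable_tuncons d) (@tconsK d).
by exists q; rewrite -qE.
Qed.

Let lt0 d : lebesgue_tuple d set0 = 0%E.
Proof. by have [m ->] := lebesgue_tuple_sigma_finite d; exact: measure0. Qed.

Let lt_ge0 d A : (0 <= lebesgue_tuple d A)%E.
Proof. by have [m ->] := lebesgue_tuple_sigma_finite d; exact: measure_ge0. Qed.

Let lt_sigma d : semi_sigma_additive (lebesgue_tuple d).
Proof.
have [m ->] := lebesgue_tuple_sigma_finite d.
exact: measure_semi_sigma_additive.
Qed.

HB.instance Definition _ d := isMeasure.Build _ _ _ (lebesgue_tuple d)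
  (lt0 d) (@lt_ge0 d) (@lt_sigma d).

Let lt_sigma_finite d : sigma_finite setT (lebesgue_tuple d).
Proof.
by have [m ->] := lebesgue_tuple_sigma_finite d; exact: sigma_finiteT.
Qed.

HB.instance Definition _ d := Measure_isSigmaFinite.Build _ _ _
  (lebesgue_tuple d) (@lt_sigma_finite d).

Lemma lebesgue_tuple_box d (A : 'I_d -> set R) :
  (forall i, measurable (A i)) ->
  lebesgue_tuple d [set x | forall i, A i (tnth x i)] =
  (\prod_(i < d) lebesgue_measure (A i))%E.
Proof.
elim: d A => [|d IH] A mA.
  by rewrite big_ord0 /= diracE mem_set//= => -[].
rewrite big_ord_recl -IH//= /pushforward.
pose B := [set x : d.-tuple R | forall i, A (lift ord0 i) (tnth x i)].
rewrite [X in (_ \x _)%E X](_ : _ = A ord0 `*` B).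
  rewrite product_measure1E//; first exact: mA.
  rewrite (_ : B = \bigcap_(i in [set: 'I_d])
      (fun x => tnth x i) @^-1` A (lift ord0 i)).
    apply: fin_bigcap_measurable => // i _.
    by rewrite -[X in measurable X]setTI; exact: measurable_tnth.
  by apply/seteqP; split => [x Bx i _|x Bx i]; exact: Bx.
apply/seteqP; split => [[x t] /= H|[x t] /= [Ax Bt] i].
  by split => [|i]; [exact: (H ord0)|have := H (lift ord0 i); rewrite tnthS].
by have [j ->|->//] := unliftP ord0 i; rewrite tnthS; exact: Bt.
Qed.

End lebesgue_measure_tuple.
Arguments lebesgue_tuple {R} d.

Section probability_definitions.
Context {R : realType}.

Definition has_density d (T : measurableType d) (mu nu : set T -> \bar R)
    (f : T -> R) : Prop :=
  [/\ measurable_fun [set: T] f, forall x, 0 <= f x &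
      forall A, measurable A -> mu A = (\int[nu]_(x in A) (f x)%:E)%E].

Definition mutually_independent dT (T : measurableType dT) (P : probability T R)
    d' (T' : measurableType d') (I : eqType) (X : I -> {RV P >-> T'}) : Prop :=
  forall (J : seq I) (A : I -> set T'), uniq J -> (forall i, measurable (A i)) ->
    P (\bigcap_(i in [set` J]) X i @^-1` A i) =
    (\prod_(i <- J) P (X i @^-1` A i))%E.

Definition iid dT (T : measurableType dT) (P : probability T R)
    d' (T' : measurableType d') (I : eqType) (X : I -> {RV P >-> T'})
    (mu : set T' -> \bar R) : Prop :=
  mutually_independent X /\
  forall i A, measurable A -> distribution P (X i) A = mu A.

End probability_definitions.
Arguments mutually_independent {R dT T} P {d' T' I} X.
Arguments iid {R dT T} P {d' T' I} X mu.

Section nearest_neighbour.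
Context {R : realType} {d n : nat}.
Implicit Types x : 'I_n -> d.-tuple R.

(* The minimum is taken in the extended reals, +oo being the value of an empty
   minimum, which does not occur for n >= 2. *)
Definition nn_dist x (i : 'I_n) : R :=
  fine (\big[mine/+oo%E]_(j < n | j != i) (enorm (vsub (x i) (x j)))%:E).

(* The maximum is taken in the extended reals, -oo being the value of an empty
   maximum, which does not occur for n >= 1. *)
Definition max_nn_ball (mu : set (d.-tuple R) -> \bar R) x : R :=
  fine (\big[maxe/-oo%E]_(i < n) mu (eball (x i) (nn_dist x i))).

End nearest_neighbour.

(* Main.v *)
(* Put p = (y + ln n) / n, so that the event reads P_n >= p, and let g_x(r) be the
   mu-mass of the ball of radius r around x. By monotonicity of g_x, P_n >= p
   means that for some i, g_{X_i}(|X_i - X_j|) >= p for all j != i. Spheres are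
   mu-null, so g_x(|X - x|) is uniform on [0, 1]; given X_i = x the n - 1 events
   are independent of probability 1 - p. For p <= 1 the union bound yields
   n (1 - p)^(n - 1) <= n exp (- (n - 1) p), which is the claim; for p > 1 the
   event is empty. *)
From HB Require Import structures.
Require Import Defs.
From mathcomp Require Import all_boot all_order all_algebra.
From mathcomp Require Import all_classical all_reals all_analysis.
From mathcomp Require Import measurable_realfun ring.

Set Implicit Arguments.
Unset Strict Implicit.
Unset Printing Implicit Defensive.

Import Order.TTheory GRing.Theory Num.Theory.
Import numFieldNormedType.Exports.

Local Open Scope classical_set_scope.
Local Open Scope ring_scope.

(** * Conditioning on one of finitely many independent variables *)

Section independence.
Context {R : realType} {dT : measure_display} {T : measurableType dT}.
Context (P : probability T R) {dS : measure_display} {S : measurableType dS}.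
Context {I : eqType} (X : I -> {RV P >-> S}).

Definition jtuple m (J : m.-tuple I) (w : T) : m.-tuple S :=
  [tuple X (tnth J k) w | k < m].

Lemma measurable_jtuple m (J : m.-tuple I) : measurable_fun setT (jtuple J).
Proof.
apply/measurable_fun_tnthP => k.
rewrite (_ : _ \o _ = X (tnth J k))//.
by apply/funext => w /=; rewrite tnth_mktuple.
Qed.

(** The sides are indexed by [I] and not by positions, to fit the families of sets in
    [mutually_independent]. *)
Definition jbox m (J : m.-tuple I) (A : I -> set S) : set (m.-tuple S) :=
  [set t | forall k, A (tnth J k) (tnth t k)].

Lemma measurable_jbox m (J : m.-tuple I) (A : I -> set S) :
  (forall i, measurable (A i)) -> measurable (jbox J A).
Proof.
move=> mA; rewrite (_ : jbox J A = \bigcap_(k in [set: 'I_m])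
    (fun x => tnth x k) @^-1` A (tnth J k)).
  apply: fin_bigcap_measurable => // k _.
  by rewrite -[X in measurable X]setTI; exact: measurable_tnth.
by apply/seteqP; split => [x Bx i _|x Bx i]; exact: Bx.
Qed.

(** A cylinder over coordinate [k] is the box whose sides are all full except the one at [tnth J k];
    as [J] has no repetition, that side constrains no other coordinate. *)
Lemma measurable_tuple_jbox m (J : m.-tuple I) : uniq J ->
  measurable =
  <<s [set jbox J A | A in [set A : I -> set S | forall i, measurable (A i)]] >>
  :> set (set (m.-tuple S)).
Proof.
move=> uJ; apply/seteqP; split.
  apply: smallest_sub; first exact: smallest_sigma_algebra.
  rewrite -bigcup_seq; apply: bigcup_sub => k _ _ [Y mY <-].
  apply: sub_sigma_algebra; exists (fun j => if j == tnth J k then Y else setT).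
    by move=> j; case: ifP.
  apply/seteqP; split => [t /(_ k)|t [_ Yt] l]; rewrite /jbox/= ?eqxx//.
  by case: ifPn => // /eqP /(tuple_uniqP _ uJ) ->.
apply: smallest_sub; first exact: sigma_algebra_measurable.
by move=> _ [A mA <-]; exact: measurable_jbox.
Qed.

Lemma preimage_jbox m (J : m.-tuple I) (A : I -> set S) :
  jtuple J @^-1` jbox J A = \bigcap_(j in [set` J]) X j @^-1` A j.
Proof.
apply/seteqP; split => w /=.
  by move=> JA j /= /tnthP[k ->]; have := JA k; rewrite tnth_mktuple.
by move=> JA k; rewrite tnth_mktuple; apply: JA; exact: mem_tnth.
Qed.

Hypothesis indX : mutually_independent P X.

(** For fixed [B], both sides are finite measures in [C]. They agree on boxes by mutual
    independence, and boxes generate the sigma-algebra and are closed under intersection. *)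
Lemma independent_jtuple m (i : I) (J : m.-tuple I) (B : set S)
    (C : set (m.-tuple S)) : uniq (i :: J) -> measurable B -> measurable C ->
  P (X i @^-1` B `&` jtuple J @^-1` C) =
  (P (X i @^-1` B) * P (jtuple J @^-1` C))%E.
Proof.
move=> /= /andP[iJ uJ] mB mC.
have mXB : measurable (X i @^-1` B).
  by rewrite -[X in measurable X]setTI; exact: measurable_funPT.
have mV := measurable_jtuple J.
pose c := NngNum (fine_ge0 (measure_ge0 P (X i @^-1` B))).
(* The pushforward is a measure only for a measurable map: both definitions take
   the measurability of jtuple J as an argument. *)
pose m1 : {measure set (m.-tuple S) -> \bar R} :=
  pushforward (mrestr P mXB) (jtuple J).
pose m2 : {measure set (m.-tuple S) -> \bar R} :=
  mscale c (pushforward P (jtuple J)).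
have -> : P (X i @^-1` B `&` jtuple J @^-1` C) = m1 mV C by rewrite setIC.
have -> : (P (X i @^-1` B) * P (jtuple J @^-1` C))%E = m2 mV C.
  by rewrite /m2 /= /mscale /= fineK// fin_num_measure.
apply: (measure_unique [set jbox J A |
    A in [set A : I -> set S | forall i, measurable (A i)]] (fun=> setT)) => //.
- exact: measurable_tuple_jbox.
- move=> _ _ [A mA <-] [A' mA' <-]; exists (fun j => A j `&` A' j).
    by move=> j; exact: measurableI.
  apply/seteqP; split => [t At|t [At A't] k]; last by split.
  by split => k; case: (At k).
- by move=> _; exists (fun=> setT) => //; apply/seteqP; split.
- exact: bigcup_const.
- move=> _ [A mA <-].
  rewrite /m1 /m2 /= /mscale /= fineK ?fin_num_measure//.
  rewrite /pushforward /mrestr /= preimage_jbox indX//.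
  (* Since [i] is not in [J], the family can be given the value [B] at [i], which turns the event
     into one intersection over [i :: J]. *)
  pose A' j := if j == i then B else A j.
  have A'A j : j \in tval J -> A' j = A j.
    by rewrite /A'; case: eqP => // ->; rewrite (negbTE iJ).
  have A'i : A' i = B by rewrite /A' eqxx.
  transitivity (P (\bigcap_(j in [set` i :: J]) X j @^-1` A' j)).
    congr (P _); apply/seteqP; split => w /=.
      move=> [wA wB] j /=; rewrite in_cons => /orP[/eqP ->|jJ].
        by rewrite A'i.
      by rewrite A'A//; exact: wA.
    move=> wA; split; first move=> j /= jJ.
      by rewrite -A'A//; apply: wA; rewrite /= in_cons jJ orbT.
    by have := wA i; rewrite A'i; apply; rewrite /= in_cons eqxx.
  rewrite indX ?big_cons /= ?iJ//; last first.
    by move=> j; rewrite /A'; case: ifP => // _; exact: mA.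
  rewrite A'i; congr (_ * _)%E; rewrite big_seq [RHS]big_seq.
  by apply: eq_bigr => j jJ; rewrite A'A.
- move=> _; rewrite /m1 /= /pushforward /mrestr.
  by rewrite preimage_setT setTI (le_lt_trans (probability_le1 _ _)) ?ltry.
Qed.

(** By uniqueness of the product measure, the joint law of [X i] and the tuple is the product of
    their laws, and the product measure integrates the masses of sections. *)
Lemma probability_jtuple m (i : I) (J : m.-tuple I) (A : set (S * m.-tuple S)) :
  uniq (i :: J) -> measurable A ->
  P [set w | A (X i w, jtuple J w)] =
  (\int[distribution P (X i)]_x P (jtuple J @^-1` xsection A x))%E.
Proof.
move=> uJ mA.
have mV := measurable_jtuple J.
pose V : {RV P >-> m.-tuple S} := HB.pack (jtuple J)
  (isMeasurableFun.Build _ _ _ _ _ mV).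
have mXV : measurable_fun setT (fun w => (X i w, jtuple J w)).
  exact: measurable_fun_pair.
pose XV : {RV P >-> (S * m.-tuple S)%type} :=
  HB.pack (fun w => (X i w, jtuple J w)) (isMeasurableFun.Build _ _ _ _ _ mXV).
rewrite -[RHS]/((distribution P (X i) \x distribution P V)%E A).
rewrite (@product_measure_unique _ _ _ _ R (distribution P (X i))
  (distribution P V) (distribution P XV))//.
move=> B C mB mC; exact: independent_jtuple.
Qed.

End independence.

(** Given [X i = x], the events for [j] in [J] are independent, each of probability
    [mu (xsection A x)]; their joint probability is at most [q ^+ size J] for every [x], hence also
    after integration over [x]. *)
Lemma iid_pairs_le (R : realType) (dT : measure_display) (T : measurableType dT)
    (P : probability T R) (dS : measure_display) (S : measurableType dS)
    (I : eqType) (X : I -> {RV P >-> S}) (mu : probability S R)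
    (A : set (S * S)) (q : R) (i : I) (J : seq I) :
  iid P X mu -> measurable A -> (forall x, (mu (xsection A x) <= q%:E)%E) ->
  uniq (i :: J) ->
  (P (\bigcap_(j in [set` J]) [set w | A (X i w, X j w)]) <=
   (q ^+ size J)%:E)%E.
Proof.
move=> [indX distX] mA Aq uiJ.
have muX j B : measurable B -> P (X j @^-1` B) = mu B by exact: distX.
(* Any point of [S] gives this bound, and [S] is not empty because [mu] has total mass 1. *)
have q0 : 0 <= q.
  have [x|noS] := pselect (inhabited S).
    by case: x => x; rewrite -lee_fin; apply: le_trans (Aq x).
  have := probability_setT mu; rewrite (_ : setT = set0) ?measure0.
    by move=> /esym/eqP; rewrite onee_eq0.
  by apply/seteqP; split => // x; case: noS.
pose C : set (S * (size J).-tuple S) :=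
  \bigcap_(k in [set: 'I_(size J)]) [set z | A (z.1, tnth z.2 k)].
have mC : measurable C.
  apply: fin_bigcap_measurable => // k _.
  rewrite -[X in measurable X]setTI.
  apply: (@measurable_fun_pair _ _ _ _ _ _ fst (fun z => tnth z.2 k)) => //.
  apply: (@measurableT_comp _ _ _ _ _ _ (fun t : (size J).-tuple S => tnth t k)
    _ snd) => //.
  exact: measurable_tnth.
have -> : \bigcap_(j in [set` J]) [set w | A (X i w, X j w)] =
    [set w | C (X i w, jtuple X (in_tuple J) w)].
  apply/seteqP; split => [w wA k _ /=|w wC j /= jJ].
    by rewrite tnth_mktuple; apply: wA; exact: mem_tnth.
  have /tnthP[k ->] : j \in in_tuple J by [].
  by have := wC k Logic.I; rewrite /= tnth_mktuple.
rewrite probability_jtuple//.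
(* The section of [C] at [x] is a box with all sides equal to [xsection A x]. *)
have CE x : P (jtuple X (in_tuple J) @^-1` xsection C x) =
    (\prod_(j <- J) mu (xsection A x))%E.
  rewrite (_ : xsection C x = jbox (in_tuple J) (fun=> xsection A x)).
    rewrite preimage_jbox indX//; last first.
    - by move=> ?; exact: measurable_xsection.
    - by case/andP: uiJ.
    by apply: eq_bigr => j _; rewrite muX//; exact: measurable_xsection.
  apply/seteqP; split => t.
    by rewrite /xsection/= inE => + k => /(_ k Logic.I)/=; rewrite inE.
  by rewrite /xsection/= inE => + k _ => /(_ k)/=; rewrite inE.
under eq_integral do rewrite CE.
have Cq x : (\prod_(j <- J) mu (xsection A x) <= (q ^+ size J)%:E)%E.
  elim: J {uiJ C mC CE} => [|j J IH]; first by rewrite big_nil.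
  rewrite big_cons/= exprS EFinM lee_pmul//.
  by apply: prode_ge0 => k _.
apply: (@le_trans _ _ (\int[distribution P (X i)]_x (q ^+ size J)%:E)%E).
  apply: ge0_le_integral => //.
  - by move=> x _; apply: prode_ge0.
  - under eq_fun do rewrite -CE.
    have mV := measurable_jtuple X (in_tuple J).
    pose V : {RV P >-> (size J).-tuple S} := HB.pack (jtuple X (in_tuple J))
      (isMeasurableFun.Build _ _ _ _ _ mV).
    exact: (measurable_fun_xsection (distribution P V)).
rewrite integral_cst//= probability_setT mule1//.
Qed.

(** * Measurability of balls and of their masses *)

Section euclidean_balls.
Context {R : realType} {d : nat}.
Local Notation Rd := (d.-tuple R).

Lemma enorm_vsubC (x y : Rd) : enorm (vsub x y) = enorm (vsub y x).
Proof.
rewrite /enorm; congr Num.sqrt; apply: eq_bigr => i _.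
by rewrite !tnth_mktuple -[LHS]sqrrN opprB.
Qed.

Lemma measurable_enorm_vsub dT (T : measurableType dT) (u v : T -> Rd) :
  measurable_fun setT u -> measurable_fun setT v ->
  measurable_fun setT (fun t => enorm (vsub (u t) (v t))).
Proof.
move=> /measurable_fun_tnthP mu /measurable_fun_tnthP mv.
rewrite /enorm.
apply: (@measurableT_comp _ _ _ _ _ _ (@Num.sqrt R)).
  apply: continuous_measurable_fun; exact: sqrt_continuous.
apply: measurable_sum => i; apply: measurable_funX.
under eq_fun do rewrite tnth_mktuple.
by apply: measurable_funB; [exact: mu|exact: mv].
Qed.

Lemma measurable_enorm_le dT (T : measurableType dT) (u v : T -> Rd)
    (g : T -> R) :
  measurable_fun setT u -> measurable_fun setT v -> measurable_fun setT g ->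
  measurable [set t | enorm (vsub (u t) (v t)) <= g t].
Proof.
move=> mu mv mg; rewrite -[X in measurable X]setTI.
exact: (measurable_fun_ler (measurable_enorm_vsub mu mv) mg measurableT
  (Y := [set true])).
Qed.

Lemma measurable_eball (x : Rd) (r : R) : measurable (eball x r).
Proof.
by apply: measurable_enorm_le => //; exact: measurable_cst.
Qed.

Lemma measurable_sphere (x : Rd) (r : R) :
  measurable [set z : Rd | enorm (vsub z x) = r].
Proof.
rewrite -[X in measurable X]setTI.
have mf := measurable_enorm_vsub (@measurable_id _ Rd setT) (measurable_cst x).
exact: mf measurableT [set r] (measurable_set1 r).
Qed.

Lemma eball_le (x : Rd) (r s : R) : r <= s -> eball x r `<=` eball x s.
Proof. by move=> rs y /le_trans; exact. Qed.

(** The mass is that of the section at [z] of a measurable set [B] of triples, hence a measurable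
    function of [z]. *)
Lemma measurable_eball_mass_ge (mu : probability Rd R) (p : \bar R) :
  measurable [set z : Rd * Rd |
    (p <= mu (eball z.1 (enorm (vsub z.1 z.2))))%E].
Proof.
pose B := [set u : (Rd * Rd) * Rd |
  enorm (vsub u.2 u.1.1) <= enorm (vsub u.1.1 u.1.2)].
have mB : measurable B.
  have m11 : measurable_fun setT (fun u : (Rd * Rd) * Rd => u.1.1).
    exact: measurableT_comp.
  have m12 : measurable_fun setT (fun u : (Rd * Rd) * Rd => u.1.2).
    exact: measurableT_comp.
  by apply: measurable_enorm_le => //; exact: measurable_enorm_vsub.
have := measurable_fun_xsection mu mB => mf.
rewrite (_ : [set z | _] = setT `&` (mu \o xsection B) @^-1` [set` `[p, +oo[]).
  by apply: mf => //; exact: emeasurable_itv.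
rewrite setTI; apply/seteqP; split => z /=; rewrite in_itv/= andbT xsectionE//.
Qed.

End euclidean_balls.

(** * Null spheres and the law of the mass of a random ball *)

Lemma lebesgue_tuple_sphere (R : realType) (d : nat) (x : d.+1.-tuple R)
    (r : R) : lebesgue_tuple d.+1 [set z | enorm (vsub z x) = r] = 0%E.
Proof.
pose Rd : measurableType _ := d.-tuple R.
have mS := measurable_sphere x r.
rewrite /= /pushforward.
set S := _ @^-1` _.
have {mS} mS : measurable S.
  by rewrite -[S]setTI; apply: measurable_tcons.
(* Both orders of integration give the same product measure; in this one the sections are subsets of
   the first coordinate line. *)
rewrite (@product_measure_unique _ _ _ Rd R lebesgue_measure (lebesgue_tuple d)
  (lebesgue_measure \x^ lebesgue_tuple d)%E) //; last first.
  by move=> A B mA mB; exact: product_measure2E.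
rewrite /= /product_measure2; apply: integral0_eq => t _ /=.
(* By Fubini: each line in the first coordinate meets the sphere in at most two
   points. *)
apply: countable_lebesgue_measure0; apply: finite_set_countable.
(* Half the length of the chord that the sphere cuts from the line; the radicand is nonnegative
   whenever the line meets the sphere. *)
pose a := Num.sqrt (r ^+ 2 -
  \sum_(i < d) (tnth t i - tnth x (lift ord0 i)) ^+ 2).
apply: (@sub_finite_set _ _ [set tnth x ord0 + a; tnth x ord0 - a]); last first.
  by rewrite finite_setU; split; exact: finite_set1.
move=> s; rewrite ysectionE /S /= => enr.
have : (s - tnth x ord0) ^+ 2 = a ^+ 2.
  have : (s - tnth x ord0) ^+ 2 +
      \sum_(i < d) (tnth t i - tnth x (lift ord0 i)) ^+ 2 = r ^+ 2.
    rewrite -enr sqr_sqrtr; last by apply: sumr_ge0 => i _; exact: sqr_ge0.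
    rewrite big_ord_recl tnth_mktuple/=; congr (_ + _).
    by apply: eq_bigr => i _; rewrite tnth_mktuple tnthS.
  move=> /(canRL (addrK _)) e; rewrite /a -e sqr_sqrtr ?sqr_ge0//.
move/eqP; rewrite eqf_sqr => /orP[]/eqP e; [left|right] => /=.
  by rewrite -e addrC subrK.
by rewrite -e addrC subrK.
Qed.

Lemma has_density_null (R : realType) dT (T : measurableType dT)
    (mu : set T -> \bar R) (nu : {measure set T -> \bar R}) (f : T -> R)
    (A : set T) :
  has_density mu nu f -> measurable A -> nu A = 0%E -> mu A = 0%E.
Proof.
move=> [mf _ muE] mA nuA; rewrite muE//; apply: null_set_integral => //.
by apply: measurable_funTS; exact/measurable_EFinP.
Qed.

(* With r the least radius at which the ball around x has mass at least p, the
   open ball of radius r has the same mass as the closed one, and every point of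
   the event lies outside of it. *)
Lemma eball_mass_ge_le (R : realType) (d : nat) (mu : probability (d.-tuple R) R)
    (x : d.-tuple R) (p : R) :
  (forall r, mu [set z | enorm (vsub z x) = r] = 0%E) -> p <= 1 ->
  (mu [set z | (p%:E <= mu (eball x (enorm (vsub x z))))%E] <= (1 - p)%:E)%E.
Proof.
move=> sphere0 p1; set D := [set z | _].
have mN : measurable_fun setT (fun z => enorm (vsub z x)).
  by apply: measurable_enorm_vsub => //; exact: measurable_cst.
have mD : measurable D.
  have := measurable_xsection x (measurable_eball_mass_ge mu p%:E).
  by rewrite xsectionE.
(* The condition [0 <= r] bounds [E] from below, so that a nonempty [E] has an infimum. If [E] is
   empty, so is [D]. *)
pose E := [set r | 0 <= r /\ (p%:E <= mu (eball x r))%E].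
have [E0|noE] := pselect (E !=set0); last first.
  rewrite (_ : D = set0) ?measure0 ?lee_fin ?subr_ge0//.
  apply/seteqP; split => // z Dz; apply: noE.
  by exists (enorm (vsub x z)); split => //; exact: sqrtr_ge0.
have infE : has_inf E by split => //; exists 0 => r [].
set r := inf E.
have mass_r : (p%:E <= mu (eball x r))%E.
  (* The balls of radius [r + 1/(k+1)] decrease to the closed ball of radius [r], and each contains
     a ball with radius in [E]; continuity of [mu] from above passes the bound to the limit. *)
  pose F k := eball x (r + k.+1%:R^-1).
  have capF : \bigcap_k F k = eball x r.
    apply/seteqP; split => z /= Fz; last first.
      by move=> k _; apply: le_trans Fz _; rewrite lerDl invr_ge0.
    rewrite /eball /= leNgt; apply/negP => /ltr_add_invr[k].
    by rewrite ltNge (Fz k).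
  rewrite -capF.
  have mF k : measurable (F k) by exact: measurable_eball.
  apply: (@cvge_to_ge _ (nbhs \oo) _ _ (mu \o F)).
    apply: nonincreasing_cvg_mu => //.
    - by rewrite -ge0_fin_numE// fin_num_measure.
    - exact: bigcapT_measurable.
    - move=> k l kl; apply/subsetPset; apply: eball_le.
      by rewrite lerD2l lef_pV2 ?posrE ?ltr0n// ler_nat ltnS.
  apply: nearW => k /=.
  have [|s [_ /le_trans]] := @inf_adherent _ E k.+1%:R^-1 _ infE.
    by rewrite invr_gt0.
  move=> + sr; apply; rewrite le_measure ?inE//; first exact: measurable_eball.
  by apply: eball_le; exact: ltW.
pose U := [set z | enorm (vsub z x) < r].
have mU : measurable U.
  rewrite -[U]setTI.
  rewrite (_ : U = (fun z => enorm (vsub z x)) @^-1` `]-oo, r[%classic).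
    by apply: mN => //; exact: measurable_itv.
  by apply/seteqP; split => z; rewrite /U/= in_itv.
have pU : (p%:E <= mu U)%E.
  apply: (le_trans mass_r).
  have mS := measurable_sphere x r.
  rewrite (_ : eball x r = U `|` [set z | enorm (vsub z x) = r]).
    by apply: (le_trans (measureU2 mu mU mS)); rewrite /= sphere0 adde0.
  apply/seteqP; split => z; rewrite /eball /U /=.
    by rewrite le_eqVlt => /orP[/eqP|]; [right|left].
  by case=> [/ltW//|->].
(* For [z] in [D], the distance from [x] to [z] belongs to [E], so it is at least [r]. *)
have DU : D `<=` ~` U.
  move=> z Dz; rewrite /U /= => zr.
  suff : r <= enorm (vsub x z) by rewrite enorm_vsubC leNgt zr.
  by apply: ge_inf; [case: infE|split => //; exact: sqrtr_ge0].
apply: (@le_trans _ _ (mu (~` U))).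
  by rewrite le_measure ?inE//; exact: measurableC.
by rewrite probability_setC// EFinB leeB.
Qed.

(** * From the nearest-neighbour event to the union bound *)

(** As [n >= 2], minimum and maximum are attained and no infinite default value occurs. One
    direction holds because the mass grows with the radius, the other by taking [j] to be the
    nearest neighbour of [i]. *)
Lemma max_nn_ball_ge (R : realType) (d n : nat) (mu : probability (d.-tuple R) R)
    (x : 'I_n -> d.-tuple R) (p : R) : (2 <= n)%N ->
  p <= max_nn_ball mu x <->
  exists i, forall j, j != i ->
    (p%:E <= mu (eball (x i) (enorm (vsub (x i) (x j)))))%E.
Proof.
move=> n2.
have n0 : (0 < n)%N by exact: ltnW.
have nn_distP i : exists2 j, j != i &
    nn_dist x i = enorm (vsub (x i) (x j)) /\
    forall k, k != i -> nn_dist x i <= enorm (vsub (x i) (x k)).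
  have [j ji] : exists j : 'I_n, j != i.
    have [->|i0] := eqVneq i (Ordinal n0); first by exists (Ordinal n2).
    by exists (Ordinal n0); rewrite eq_sym.
  have [|k ki kE] := @eq_bigmin _ _ _ +oo%E j (fun j => j != i)
    (fun j => (enorm (vsub (x i) (x j)))%:E) ji; first by move=> *; exact: leey.
  exists k => //; rewrite /nn_dist kE; split=> // l li.
  by rewrite -lee_fin -kE; exact: bigmin_le_cond.
have [|m _ mE] := @eq_bigmax _ _ _ -oo%E (Ordinal n0) xpredT
  (fun i => mu (eball (x i) (nn_dist x i))) isT; first by move=> *; exact: leNye.
have mB i r : measurable (eball (x i) r) by exact: measurable_eball.
rewrite /max_nn_ball mE -lee_fin fineK ?fin_num_measure//; split.
  move=> pm; exists m => j jm; apply: (le_trans pm).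
  by rewrite le_measure ?inE//; apply: eball_le; have [_ _ [_]] := nn_distP m; exact.
move=> [i pi]; rewrite -mE.
have [j ji [jE _]] := nn_distP i.
apply: (bigmax_sup i) => //.
by rewrite jE; exact: pi.
Qed.

Theorem theorem1 (R : realType) (dT : measure_display) (T : measurableType dT)
    (P : probability T R) (d : nat) (hd : (1 <= d)%N)
    (mu : probability (d.-tuple R) R) (f : d.-tuple R -> R)
    (mu_density : has_density mu (lebesgue_tuple d) f)
    (X : nat -> {RV P >-> d.-tuple R}) (X_iid : iid P X mu)
    (n : nat) (hn : (2 <= n)%N) (y : R) :
  let Pn (w : T) : R := max_nn_ball mu (fun i : 'I_n => X i w) in
  (P [set w | (y <= n%:R * Pn w - ln n%:R)%R] <=
    (expR (- ((n%:R - 1) / n%:R) * y + ln n%:R / n%:R)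
      * \1_[set z : R | (z <= n%:R - ln n%:R)%R] y)%:E)%E.
Proof.
(* Dimension 0 is discarded first: spheres are null only from dimension 1 on. *)
case: d hd mu f mu_density X X_iid => [//|d] _ mu f fmu X iidX.
cbv zeta; pose Pn (w : T) : R := max_nn_ball mu (fun i : 'I_n => X i w).
rewrite -/Pn.
set p := (y + ln n%:R) / n%:R.
have n0 : (0 < n%:R :> R) by rewrite ltr0n ltnW.
have eventE w : (y <= n%:R * Pn w - ln n%:R) = (p <= Pn w).
  by rewrite lerBrDr /p ler_pdivrMr// mulrC.
have PnP w := @max_nn_ball_ge R d.+1 n mu (fun i : 'I_n => X i w) p hn.
have p_le1 : (y <= n%:R - ln n%:R) = (p <= 1).
  by rewrite lerBrDr /p ler_pdivrMr// mul1r.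
rewrite indicE (_ : (y \in _) = (p <= 1)); last first.
  by rewrite -p_le1; apply/idP/idP; rewrite inE.
(* For [p > 1] the indicator vanishes, and the event would require a ball of mass above 1; an index
   [j != i] exists as [n >= 2]. *)
have [p1|p1] := leP p 1; last first.
  rewrite mulr0 (_ : [set w | _] = set0) ?measure0//.
  apply/seteqP; split => // w /=; rewrite eventE => /PnP[i pmu].
  have [j ji] : exists j : 'I_n, j != i.
    have [->|i0] := eqVneq i (Ordinal (ltnW hn)); first by exists (Ordinal hn).
    by exists (Ordinal (ltnW hn)); rewrite eq_sym.
  have := le_trans (pmu _ ji) (probability_le1 mu (measurable_eball _ _)).
  by rewrite lee_fin leNgt p1.
rewrite mulr1.
pose A := [set z : d.+1.-tuple R * d.+1.-tuple R |
  (p%:E <= mu (eball z.1 (enorm (vsub z.1 z.2))))%E].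
have mA : measurable A by exact: measurable_eball_mass_ge.
have Ap x : (mu (xsection A x) <= (1 - p)%:E)%E.
  rewrite xsectionE; apply: eball_mass_ge_le => // r.
  apply: (has_density_null fmu); first exact: measurable_sphere.
  exact: lebesgue_tuple_sphere.
pose J i := [seq j <- iota 0 n | j != i].
have JP i j : (j \in J i) = (j != i) && (j < n)%N.
  by rewrite mem_filter mem_iota.
have uJ i : uniq (i :: J i).
  by rewrite /= JP eqxx /= filter_uniq ?iota_uniq.
have sJ i : (i < n)%N -> size (J i) = n.-1.
  move=> ni; have := count_predC (pred1 i) (iota 0 n).
  rewrite size_iota count_uniq_mem ?iota_uniq// mem_iota ni add1n => <-.
  by rewrite size_filter.
pose B i := \bigcap_(j in [set` J i]) [set w | A (X i w, X j w)].
have mB i : measurable (B i).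
  apply: fin_bigcap_measurable => // j _.
  rewrite -[X in measurable X]setTI.
  have mXX := measurable_fun_pair (measurable_funPT (X i))
    (measurable_funPT (X j)).
  exact: mXX measurableT _ mA.
have -> : [set w | y <= n%:R * Pn w - ln n%:R] = \big[setU/set0]_(i < n) B i.
  rewrite -bigcup_mkord; apply/seteqP; split => w /=; rewrite eventE.
    move=> /PnP[i pmu]; exists i => //= j /=; rewrite JP => /andP[ji jn].
    exact: (pmu (Ordinal jn)).
  move=> [i /= ni wB]; apply/PnP; exists (Ordinal ni) => j ji.
  by apply: wB; rewrite /= JP ltn_ord andbT.
apply: (le_trans (Boole_inequality P (fun i _ => mB i))).
apply: (@le_trans _ _ (\sum_(i < n) ((1 - p) ^+ n.-1)%:E)%E).
  apply: lee_sum => i _; rewrite -(sJ _ (ltn_ord i)).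
  by apply: (iid_pairs_le iidX) => //; exact: uJ.
rewrite sumEFin lee_fin sumr_const card_ord -[leLHS]mulr_natl.
(* With this exponent the bound is [n * exp (-p) ^ (n-1)], so the claim reduces to
   [1 - p <= exp (-p)]; [p <= 1] makes [1 - p] nonnegative, so that powers preserve the
   inequality. *)
have -> : - ((n%:R - 1) / n%:R) * y + ln n%:R / n%:R =
    ln n%:R + n.-1%:R * - p.
  rewrite -[in RHS]subn1 natrB ?(ltnW hn)// /p; field.
  by rewrite gt_eqF.
rewrite expRD lnK ?posrE// ler_pM2l// expRM_natl.
by rewrite lerXn2r ?nnegrE ?expR_ge0 ?subr_ge0//; exact: expR_ge1Dx.
Qed.
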